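(* Let $n \geq 4$ be an even integer, let $D$ be the distance matrix of the wheel graph $W_n$ (vertices labelled as in the context) and let $\widetilde{L}$ be the special Laplacian of $W_n$. Let the eigenvalues of $D$ be arranged as $\mu_1 > 0 > \mu_2 \geq \cdots \geq \mu_n$ and the eigenvalues of $\widetilde{L}$ as $\lambda_1 \geq \cdots \geq \lambda_{n-1} > \lambda_n = 0$. Then \[ 0 > -\frac{2}{\lambda_1} \geq \mu_2 \geq -\frac{2}{\lambda_2} \geq \mu_3 \geq \cdots \geq -\frac{2}{\lambda_{n-1}} \geq \mu_n. \]
   Context: The wheel graph $W_n$ ($n\ge 4$) consists of a cycle on $n-1$ vertices together with a hub vertex adjacent to all cycle vertices. Label the hub $1$ and the cycle vertices $2,\dotsc,n$ in cyclic order. The distance matrix is $D=[d_{ij}]$ where $d_{ij}$ is the length of a shortest path between $i$ and $j$. For $c=(c_1,\dotsc,c_m)$, $\mathrm{Circ}(c)$ denotes the $m\times m$ circulant matrix whose $(i,j)$ entry is $c_{((j-i) \bmod m)+1}$. Special Laplacian: for $n\ge4$ even and $k\in\{1,\dotsc,\frac n2-1\}$, let $c^k\in\mathbb{R}^{n-1}$ have $c^k_j=1$ if $j=k+1$ or $j=n-k$ and $c^k_j=0$ otherwise, and let $C_k=\mathrm{Circ}(c^k)$ (of order $n-1$). Then \[\widetilde{L} := \frac{n-1}{2} I - \frac12\begin{bmatrix}0 & \mathbf{1}'\\ \mathbf{1} & 0\end{bmatrix} + \sum_{k=1}^{\frac n2 -1} (-1)^k \frac{(n-1)-2k}{2}\begin{bmatrix}0&0\\0&C_k\end{bmatrix},\]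 where $\mathbf{1}$ is the all-ones vector of length $n-1$. *)

(* Defs.v *)
From HB Require Import structures.
From mathcomp Require Import all_boot all_order all_algebra.

Set Implicit Arguments.
Unset Strict Implicit.
Unset Printing Implicit Defensive.

Import Order.TTheory GRing.Theory Num.Theory.
Local Open Scope ring_scope.

(* Length of a shortest e-path from x to y.  Shortest paths have length < #|T|;
   the value is #|T| when y is not reachable from x. *)
Definition gdist (T : finType) (e : rel T) (x y : T) : nat :=
  find (fun k => [exists p : k.-tuple T, path e x p && (last x p == y)])
       (iota 0 #|T|).

Definition dist_mx (R : pzRingType) (n : nat) (e : rel 'I_n) : 'M[R]_n :=
  \matrix_(i, j) (gdist e i j)%:R.

(* The wheel graph on n vertices.  Vertex sets and matrices are indexed by
   'I_(1 + n.-1), so that the hub is the first block (index 0) and the n - 1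
   cycle vertices, in cyclic order, are the second one. *)
Definition wheel (n : nat) : rel 'I_(1 + n.-1) := fun u v =>
  match split u, split v with
  | inl _, inl _ => false
  | inl _, inr _ | inr _, inl _ => true
  | inr a, inr b => (b == a.+1 %% n.-1 :> nat)%N || (a == b.+1 %% n.-1 :> nat)%N
  end.
Arguments wheel : clear implicits.

(* The entries of the vector c are numbered from 1; j + m - i is j - i mod m. *)
Definition Circ (R : Type) (m : nat) (c : nat -> R) : 'M[R]_m :=
  \matrix_(i, j) c ((j + m - i) %% m)%N.+1.

Definition wheel_c (R : pzRingType) (n k j : nat) : R :=
  ((j == k.+1) || (j == n - k)%N)%:R.

Definition wheel_C (R : pzRingType) (n k : nat) : 'M[R]_n.-1 :=
  Circ n.-1 (wheel_c R n k).

Definition special_laplacian (R : fieldType) (n : nat) : 'M[R]_(1 + n.-1) :=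
  (n.-1%:R / 2)%:M
  - 2^-1 *: block_mx 0 (const_mx 1) (const_mx 1) 0
  + \sum_(1 <= k < n./2)
      ((-1) ^+ k * ((n.-1%:R - 2 * k%:R) / 2)) *:
        block_mx 0 0 0 (wheel_C R n k).

(* mu 1 >= ... >= mu n are the eigenvalues of A, with multiplicity; the values
   of mu outside 1, ..., n are irrelevant. *)
Definition arranged_eigenvalues (R : numDomainType) (n : nat) (A : 'M[R]_n)
    (mu : nat -> R) : Prop :=
  char_poly A = \prod_(1 <= i < n.+1) ('X - (mu i)%:P) /\
  (forall i j : nat, (1 <= i)%N -> (i <= j)%N -> (j <= n)%N -> mu j <= mu i).

(* Main.v *)
Require Import Defs.
From HB Require Import structures.
From mathcomp Require Import all_boot all_order all_algebra.
From mathcomp Require Import ring lra zify.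

Set Implicit Arguments.
Unset Strict Implicit.
Unset Printing Implicit Defensive.

Import Order.TTheory GRing.Theory Num.Theory.
Local Open Scope ring_scope.

(* Put m = n - 1 and let E be the signless Laplacian of the m-cycle.  The
   cyclic block of D is 2 J - E, and that of L~ is M = 2 E^-1.  On the vectors
   supported on the cycle and orthogonal to the all-ones vector, D = - E and
   L~ = 2 E^-1, so D and - 2 / L~ have the same m - 1 eigenvalues there, all
   negative.  On the remaining plane D has the roots p > 0 > v of
   X^2 - (2 m - 4) X - m, and L~ has the eigenvalues 0 and n / 2.  Hence the two
   sequences to be compared are one common list with v, resp. - 4 / n, inserted,
   and they interlace because v <= - 4 / n. *)


(** * Interlacing of sorted lists *)

(** In a nonincreasing list the entries [>= x] form an initial segment, so position [i] lies in it
    exactly when [i] is below its length. *)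
Lemma le_nth_count (R : realDomainType) (s : seq R) (i : nat) (x : R) :
  sorted >=%R s -> (i < size s)%N ->
  (x <= s`_i) = (i < count (>= x) s)%N.
Proof.
elim: s i => [|y s IHs] i //= ys.
have c0 : y < x -> count (>= x) s = 0%N.
  move=> yx; apply/eqP; rewrite -leqn0 leqNgt -has_count; apply/hasPn => z zs.
  have /allP/(_ z zs) /= zy := order_path_min (rev_trans le_trans) ys.
  by rewrite -ltNge (le_lt_trans zy).
case: i => [_|i lti].
  by case: (leP x y) => //= /c0 ->.
rewrite IHs ?(path_sorted ys) //; case: (leP x y) => //= /c0 ->.
by rewrite addn0.
Qed.

(** By [le_nth_count] both claims compare counts of entries [>= x]. The counts for [u] and [v]
    differ only through [a] and [b]: since [b <= a], that of [u] is equal or larger by one. *)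
Lemma sorted_cons_interlace (R : realDomainType) (a b : R) (s u v : seq R) :
  b <= a -> sorted >=%R u -> sorted >=%R v ->
  perm_eq u (a :: s) -> perm_eq v (b :: s) ->
  (forall i, (i < (size s).+1)%N -> v`_i <= u`_i) /\
  (forall i, (i < size s)%N -> u`_i.+1 <= v`_i).
Proof.
move=> ba su sv pu pv.
have zu : size u = (size s).+1 by rewrite (perm_size pu).
have zv : size v = (size s).+1 by rewrite (perm_size pv).
have cu x : count (>= x) u = ((x <= a)%R + count (>= x) s)%N.
  by rewrite (seq.permP pu).
have cv x : count (>= x) v = ((x <= b)%R + count (>= x) s)%N.
  by rewrite (seq.permP pv).
split=> i lti.
- rewrite le_nth_count ?zu // cu.
  have := lexx v`_i; rewrite [X in is_true X]le_nth_count ?zv // cv => h.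
  apply: (leq_trans h); rewrite leq_add2r.
  by case: (leP v`_i b) => // xb; rewrite (le_trans xb ba).
- have lti' := ltn_trans lti (ltnSn _).
  rewrite le_nth_count ?zv // cv.
  have := lexx u`_i.+1; rewrite [X in is_true X]le_nth_count ?zu // cu => h.
  have := leq_b1 (u`_i.+1 <= a); move: h.
  move: (nat_of_bool (_ <= a)) (nat_of_bool (_ <= b)) (count _ s).
  by lia.
Qed.

(** * Determinants and characteristic polynomials *)

(** The difference vanishes at 1, 2, ..., [size (p - q)], which are more points than its degree
    allows. *)
Lemma eq_poly_off0 (R : numDomainType) (p q : {poly R}) :
  (forall x, x != 0 -> p.[x] = q.[x]) -> p = q.
Proof.
move=> pq; apply/eqP; rewrite -subr_eq0; apply/eqP.
apply: (@roots_geq_poly_eq0 _ _ [seq k.+1%:R | k <- iota 0 (size (p - q))]).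
- apply/allP => x /mapP[k _ ->].
  by rewrite rootE hornerD hornerN pq ?pnatr_eq0 ?subrr.
- by rewrite map_inj_uniq ?iota_uniq // => i j /eqP; rewrite eqr_nat => /eqP[].
- by rewrite size_map size_iota.
Qed.

(** The all-ones row is a left eigenvector of [Y], so multiplying on the left by [U] clears the
    upper right block. The factor [y] is kept on the left because over polynomials it cannot be
    inverted. *)
Lemma det_border_const (K : comPzRingType) (m : nat) (a b c y : K)
    (Y : 'M[K]_m) :
  const_mx 1 *m Y = y *: (const_mx 1 : 'rV_m) ->
  y * \det (block_mx a%:M (const_mx b) (const_mx c) Y : 'M_(1 + m)) =
  (a * y - b * c * m%:R) * \det Y.
Proof.
move=> hY.
pose U : 'M[K]_(1 + m) := block_mx y%:M (const_mx (- b)) 0 1%:M.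
have -> : y = \det U by rewrite det_ublock det1 mulr1 det_scalar1.
rewrite -det_mulmx mulmx_block !mul0mx !mul1mx !add0r.
have -> : const_mx (- b) *m Y = const_mx (- b * y) :> 'M_(1, m).
  have -> : const_mx (- b) = - b *: const_mx 1 :> 'M[K]_(1, m).
    by apply/matrixP => i j; rewrite !mxE mulr1.
  by rewrite -scalemxAl hY; apply/matrixP => i j; rewrite !mxE mulr1.
have -> : y%:M *m const_mx b + const_mx (- b * y) = 0 :> 'M[K]_(1, m).
  by apply/matrixP => i j; rewrite mul_scalar_mx !mxE; ring.
rewrite det_lblock; congr (_ * _).
rewrite -scalar_mxM (mx11_scalar (_ + _)) det_scalar1 !mxE eqxx mulr1n.
under eq_bigr do rewrite !mxE.
by rewrite sumr_const card_ord -mulr_natr det_ublock det1 det_scalar1; ring.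
Qed.

Lemma horner_char_poly (K : comNzRingType) (m : nat) (A : 'M[K]_m) (x : K) :
  (char_poly A).[x] = \det (x%:M - A).
Proof.
rewrite -[LHS]/(horner_eval x (char_poly A)) -det_map_mx; congr (\det _).
apply/matrixP => i j; rewrite !mxE /= /horner_eval hornerD hornerN hornerC.
by rewrite hornerMn hornerX.
Qed.

(** For x nonzero, (x - A) B = x B - c = - x (c / x - B); taking determinants relates the two
    characteristic polynomials. *)
Lemma char_poly_scaled_inverse (R : numFieldType) (m : nat) (A B : 'M[R]_m)
    (c : R) (s : seq R) :
  A *m B = c%:M -> char_poly B = \prod_(x <- s) ('X - x%:P) ->
  all (fun x => x != 0) s ->
  char_poly A = \prod_(x <- s) ('X - (c / x)%:P).
Proof.
move=> AB hB /allP s0.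
have szs : size s = m.
  by have := size_char_poly B; rewrite hB size_prod_XsubC => -[].
have hornerB x : \det (x%:M - B) = \prod_(y <- s) (x - y).
  rewrite -horner_char_poly hB horner_prod.
  by apply: eq_bigr => y _; rewrite !hornerE.
have detB : \det B = \prod_(x <- s) x.
  have := char_poly_det B; rewrite hB coef0_prod_XsubC szs.
  by move/mulfI => ->; rewrite ?expf_neq0 // oppr_eq0 oner_eq0.
apply: eq_poly_off0 => x x0.
have dB0 : \det B != 0.
  by rewrite detB prodf_seq_neq0; apply/allP => y /s0 ->.
apply: (mulIf dB0); rewrite horner_char_poly.
rewrite -det_mulmx mulmxBl AB mul_scalar_mx.
have -> : x *: B - c%:M = - x *: ((c / x)%:M - B).
  apply/matrixP => i j; rewrite !mxE.
  by case: (i == j); rewrite ?mulr1n ?mulr0n; field.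
rewrite detZ hornerB detB horner_prod -big_split /= -szs.
(* The power of [- x] becomes a product over [s], leaving the factorwise identity (- x) (c / x - y)
   = (x - c / y) y. *)
rewrite -iter_mulr_1 -count_predT -big_const_seq -big_split /=.
apply: eq_big_seq => y /s0 y0; rewrite !hornerE; field.
by rewrite x0 y0.
Qed.


(** * Block forms of the distance matrix and of the special Laplacian *)

(** The bound on [#|T|] puts the lengths 0, 1 and 2 in the range searched by [gdist], so three tests
    settle the value. *)
Lemma gdist_diameter2 (T : finType) (e : rel T) (x y : T) :
  (2 < #|T|)%N ->
  (x != y -> ~~ e x y -> exists2 z, e x z & e z y) ->
  gdist e x y = if x == y then 0%N else if e x y then 1%N else 2%N.
Proof.
move=> hT hz; rewrite /gdist; case: #|T| hT => [|[|[|N]]] // _ /=.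
have -> : [exists p : 0.-tuple T, path e x p && (last x p == y)] = (x == y).
  by apply/existsP/idP => [[p]|xy]; [rewrite tuple0 | exists [tuple]].
case: eqVneq hz => //= xy /(_ isT) hz.
have -> : [exists p : 1.-tuple T, path e x p && (last x p == y)] = e x y.
  apply/existsP/idP => [[p]|exy].
    by case/tupleP: p => z p; rewrite tuple0 /= andbT => /andP[ez /eqP <-].
  by exists [tuple y]; rewrite /= exy eqxx.
case: ifP hz => // _ /(_ isT)[z exz ezy].
rewrite ifT //; apply/existsP; exists [tuple z; y].
by rewrite /= exz ezy eqxx.
Qed.

(** Separate summands for the two neighbours let sums split linearly; for [2 < m] they are never
    both 1. *)
Definition cycle_signless_laplacian (R : pzRingType) (m : nat) : 'M[R]_m :=
  \matrix_(i, j) (2 * (i == j)%:R + (j == ordS i)%:R + (i == ordS j)%:R).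

Lemma eq_ordS (m : nat) (i j : 'I_m) : (j == ordS i) = (i == ord_pred j).
Proof. by apply/eqP/eqP => [->|->]; rewrite ?ordSK ?ord_predK. Qed.

Lemma ord_eq_diff_mod (m : nat) (i j : 'I_m) :
  (i == j) = ((j + m - i) %% m == 0)%N.
Proof.
have li := ltn_ord i; have lj := ltn_ord j; rewrite -(inj_eq val_inj) /=.
case: (ltngtP i j) => ij.
- have -> : (j + m - i = (j - i) + m)%N by lia.
  by rewrite modnDr modn_small; lia.
- by rewrite modn_small; lia.
- by rewrite ij addKn modnn.
Qed.

Lemma ordS_neq (m : nat) (i : 'I_m) : (1 < m)%N -> (ordS i == i) = false.
Proof.
move=> hm; apply/negbTE/eqP => /(congr1 val) /=; have := ltn_ord i.
rewrite leq_eqVlt => /orP[/eqP e|lt]; first by rewrite e modnn; lia.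
by rewrite modn_small //; lia.
Qed.

Lemma ordS_ordS_neq (m : nat) (i : 'I_m) :
  (2 < m)%N -> (ordS (ordS i) == i) = false.
Proof.
move=> hm; apply/negbTE/eqP => /(congr1 val) /=; have := ltn_ord i.
rewrite leq_eqVlt => /orP[/eqP e|lt].
  by rewrite e modnn modn_small; lia.
rewrite (modn_small lt); move: lt; rewrite leq_eqVlt => /orP[/eqP e|lt].
  by rewrite e modnn; lia.
by rewrite modn_small //; lia.
Qed.

(** The hub joins any two nonadjacent cycle vertices by a path of length 2, and subtracting 2 on the
    diagonal and 1 at neighbours from the constant 2 gives the distances. *)
Lemma dist_mx_wheel (R : pzRingType) (m : nat) : (2 < m)%N ->
  dist_mx R (wheel m.+1) =
  block_mx 0%:M (const_mx 1) (const_mx 1)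
    (const_mx 2 - cycle_signless_laplacian R m) :> 'M_(1 + m).
Proof.
move=> hm; have cardT : (2 < #|{: 'I_(1 + m)}|)%N by rewrite card_ord; lia.
have gd x y : gdist (wheel m.+1) x y =
    if x == y then 0%N else if wheel m.+1 x y then 1%N else 2%N.
  apply: gdist_diameter2 => // xy exy; exists (lshift m ord0).
  - rewrite /wheel (unsplitK (inl ord0)).
    move: xy exy; rewrite /wheel.
    case: (split_ordP x) => a -> //; case: (split_ordP y) => b -> //.
    by rewrite (ord1 a) (ord1 b) eqxx.
  - rewrite /wheel (unsplitK (inl ord0)).
    move: xy exy; rewrite /wheel.
    case: (split_ordP y) => a -> //; case: (split_ordP x) => b -> //.
    by rewrite (ord1 a) (ord1 b) eqxx.
apply/matrixP => i j; rewrite [LHS]mxE gd.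
case: (split_ordP i) => a ->; case: (split_ordP j) => b ->.
- by rewrite block_mxEul (ord1 a) (ord1 b) eqxx !mxE mulr1n.
- rewrite block_mxEur eq_lrshift /wheel.
  by rewrite (unsplitK (inl a)) (unsplitK (inr b)) mxE.
- rewrite block_mxEdl eq_rlshift /wheel.
  by rewrite (unsplitK (inl b)) (unsplitK (inr a)) mxE.
rewrite block_mxEdr eq_rshift /wheel (unsplitK (inr a)) (unsplitK (inr b)) !mxE.
rewrite -[(b == _ :> nat)]/(b == ordS a) -[(a == _ :> nat)]/(a == ordS b).
case: (eqVneq a b) => [->|ab].
  by rewrite eq_sym ordS_neq ?(ltn_trans _ hm) // mulr1 !addr0 subrr.
case: (eqVneq b (ordS a)) => [->|ba] /=.
  by rewrite eq_sym ordS_ordS_neq // mulr0 add0r addr0 addrK.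
by case: (a == _); rewrite /= mulr0 !add0r ?subr0 ?addrK.
Qed.

(* The first row of the circulant block of the special Laplacian: the two
   branches [d = k] and [d = m - k] of the definition agree since m is odd. *)
Definition wheel_circ_coef (R : fieldType) (m d : nat) : R :=
  (-1) ^+ d * ((m%:R - 2 * d%:R) / 2).

Lemma special_laplacian_block (R : numFieldType) (m : nat) : odd m ->
  special_laplacian R m.+1 =
  block_mx (m%:R / 2)%:M (const_mx (- 2^-1)) (const_mx (- 2^-1))
    (\matrix_(i, j) wheel_circ_coef R m ((j + m - i) %% m)) :> 'M_(1 + m).
Proof.
move=> om; rewrite /special_laplacian /=.
have [h hm] : exists h, m = h.*2.+1.
  by exists m./2; rewrite -[LHS]odd_double_half om.
have -> : uphalf m = h.+1 by rewrite hm /= doubleK.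
have sumE : \sum_(1 <= k < h.+1) ((-1) ^+ k * ((m%:R - 2 * k%:R) / 2)) *:
      block_mx 0 0 0 (wheel_C R m.+1 k) =
    block_mx 0 0 0 (\sum_(1 <= k < h.+1)
      ((-1) ^+ k * ((m%:R - 2 * k%:R) / 2)) *: wheel_C R m.+1 k)
    :> 'M[R]_(1 + m).
  elim/big_rec2: _ => [|k A B _ ->]; first by rewrite block_mx0.
  by rewrite scale_block_mx add_block_mx !scaler0 !addr0.
rewrite sumE scalar_mx_block scale_block_mx opp_block_mx !add_block_mx.
rewrite !scaler0 !oppr0 !addr0 !add0r.
congr block_mx.
- by apply/matrixP => i j; rewrite !mxE mulr1.
- by apply/matrixP => i j; rewrite !mxE mulr1.
apply/matrixP => i j; rewrite [LHS]mxE [RHS]mxE summxE mxE.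
have m0 : (0 < m)%N by rewrite hm.
under eq_bigr do rewrite !mxE /wheel_c eqSS.
rewrite ord_eq_diff_mod; set d := (_ %% m)%N.
have dm : (d < m)%N by rewrite ltn_mod.
rewrite /wheel_circ_coef; case: eqVneq => [->|d0].
  rewrite big1_seq ?addr0 ?mul1r ?mulr1n ?mulr0 ?subr0 // => k.
  rewrite mem_index_iota => /andP[_ hk].
  have -> : (0 == k) || (1%N == m.+1 - k)%N = false by lia.
  by rewrite mulr0.
rewrite mulr0n add0r.
(* The only [k] in 1, ..., [h] whose [C_k] is nonzero at offset [d]. *)
pose k0 := if (d <= h)%N then d else (m - d)%N.
rewrite (bigD1_seq k0) ?iota_uniq //=; last first.
  by rewrite mem_index_iota /k0; case: ifP; lia.
rewrite big1_seq ?addr0 => [|k]; last first.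
  rewrite mem_index_iota => /andP[kk0 hk].
  have -> : (d == k) || (d.+1 == m.+1 - k)%N = false.
    by move: kk0; rewrite /k0; case: ifP; lia.
  by rewrite mulr0.
have -> : (d == k0) || (d.+1 == m.+1 - k0)%N by rewrite /k0; case: ifP; lia.
rewrite mulr1 /k0; case: ifP => // dh.
(* Replacing [d] by [m - d] flips the parity, as [m] is odd, and also the sign of [m - 2 d]. *)
rewrite -signr_odd oddB ?(ltnW dm) // om /= -[in RHS]signr_odd.
rewrite natrB ?(ltnW dm) //.
by case: (odd d); rewrite /= ?expr0 ?expr1; field.
Qed.

(** Up to the sign (-1)^d the coefficient is affine in [d], so this alternating second difference
    vanishes. As [m] is odd, the formula at [d = m] gives back the value at 0; but at [d = 0] the
    left neighbour is the value at [m - 1], which exceeds the formula at -1 by 2. *)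
Lemma wheel_circ_coef_recurrence (R : numFieldType) (m d : nat) :
  odd m -> (2 < m)%N -> (d < m)%N ->
  2 * wheel_circ_coef R m d + wheel_circ_coef R m ((d + m).-1 %% m)
    + wheel_circ_coef R m (d.+1 %% m) = 2 * (d == 0)%N%:R.
Proof.
move=> om hm dm; rewrite /wheel_circ_coef.
have signm1 : (-1) ^+ m.-1 = 1 :> R.
  by rewrite -signr_odd; case: m om {hm dm} => //= m /negbTE ->.
have natm1 : m.-1%:R = m%:R - 1 :> R by rewrite -subn1 natrB //; lia.
case: (posnP d) => [->|d0].
  rewrite add0n !modn_small //; try lia.
  by rewrite signm1 natm1 expr0 expr1 mulr1; field.
have [e de] : exists e, d = e.+1 by exists d.-1; lia.
rewrite de in dm *; rewrite addSn /= modnDr (modn_small (ltnW dm)) mulr0.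
have [em|em] := eqVneq e.+2 m.
  rewrite em modnn expr0.
  have -> : e = m.-2 by lia.
  have -> : m.-2.+1 = m.-1 by lia.
  have -> : (-1) ^+ m.-2 = -1 :> R.
    by rewrite -signr_odd; have -> : odd m.-2 = true by lia; rewrite expr1.
  have -> : m.-2%:R = m%:R - 2 :> R by rewrite -subn2 natrB //; lia.
  by rewrite signm1 natm1; field.
rewrite modn_small; last by lia.
by rewrite !exprS -!natr1; field.
Qed.

Lemma wheel_circ_mul_signless (R : numFieldType) (m : nat) :
  odd m -> (2 < m)%N ->
  (\matrix_(i, j) wheel_circ_coef R m ((j + m - i) %% m)) *m
    cycle_signless_laplacian R m = 2%:M.
Proof.
move=> om hm; apply/matrixP => i j; rewrite !mxE.
pose d := ((j + m - i) %% m)%N.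
have li := ltn_ord i; have lj := ltn_ord j.
have dm : (d < m)%N by rewrite ltn_mod; lia.
rewrite ord_eq_diff_mod -/d -[RHS]mulr_natr.
rewrite -(wheel_circ_coef_recurrence R om hm dm).
pose f k := wheel_circ_coef R m ((k + m - i) %% m).
(* Column [j] of the signless Laplacian is supported on [j] and its two neighbours, which leaves the
   three terms of the recurrence. *)
transitivity (\sum_(k < m) ((if k == j then 2 * f k else 0)
   + (if k == ord_pred j then f k else 0)
   + (if k == ordS j then f k else 0))).
  apply: eq_bigr => k _; rewrite !mxE eq_ordS -/(f k).
  by case: (k == j); case: (k == ord_pred j); case: (k == ordS j);
    rewrite /=; ring.
rewrite !big_split /= -!big_mkcond /= !big_pred1_eq.
(* It remains to commute the shift of [j] with the offset modulo [m]; truncated subtraction forces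
   cases on [i <= j] and on wrap-around. *)
congr (_ + wheel_circ_coef R m _ + wheel_circ_coef R m _) => /=.
- rewrite /d; case: (leqP i j) => ij.
    have -> : (j + m - i = (j - i) + m)%N by lia.
    rewrite modnDr (@modn_small (j - i)); last by lia.
    have [j0|j0] := posnP j.
      have -> : (j + m).-1 = m.-1 by lia.
      rewrite (@modn_small m.-1); last by lia.
      have -> : (m.-1 + m - i = (j - i + m).-1 + m)%N by lia.
      by rewrite modnDr.
    have -> : ((j + m).-1 = j.-1 + m)%N by lia.
    rewrite modnDr (@modn_small j.-1); last by lia.
    by have -> : (j.-1 + m - i = (j - i + m).-1)%N by lia.
  rewrite (@modn_small (j + m - i)); last by lia.
  have [j0|j0] := posnP j.
    have -> : (j + m).-1 = m.-1 by lia.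
    rewrite (@modn_small m.-1); last by lia.
    by have -> : (m.-1 + m - i = (j + m - i + m).-1)%N by lia.
  have -> : ((j + m).-1 = j.-1 + m)%N by lia.
  rewrite modnDr (@modn_small j.-1); last by lia.
  have -> : ((j + m - i + m).-1 = (j.-1 + m - i) + m)%N by lia.
  by rewrite modnDr.
- rewrite /d -[((_ - i) %% m).+1]addn1 modnDml.
  have [jm|jm] := eqVneq j.+1 m.
    have -> : (j + m - i + 1 = (0 + m - i) + m)%N by lia.
    by rewrite modnDr jm modnn.
  rewrite (@modn_small j.+1); last by lia.
  by have -> : (j + m - i + 1 = j.+1 + m - i)%N by lia.
Qed.

(** * Spectrum of the signless Laplacian of the cycle *)

Lemma sum_mul_delta (R : pzSemiRingType) (I : finType) (a : I) (g : I -> R) :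
  \sum_k g k * (k == a)%:R = g a.
Proof.
rewrite (bigD1 a) //= eqxx mulr1 big1 ?addr0 // => k /negbTE ->.
by rewrite mulr0.
Qed.

Lemma signless_laplacian_colsum (R : pzRingType) (m : nat) :
  const_mx 1 *m cycle_signless_laplacian R m = 4 *: (const_mx 1 : 'rV_m).
Proof.
apply/matrixP => i j; rewrite !mxE.
under eq_bigr do rewrite !mxE eq_ordS !mulrDr.
rewrite !big_split /= !sum_mul_delta.
under eq_bigr do rewrite mul1r.
by rewrite sum_mul_delta mulr1 !natr1.
Qed.

(** [N] is the unsigned vertex-edge incidence matrix of the cycle, edge [j] joining [j] to its
    predecessor. *)
Lemma signless_laplacian_gram (R : pzRingType) (m : nat) :
  let N : 'M[R]_m := \matrix_(i, j) ((i == j)%:R + (j == ordS i)%:R) in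
  cycle_signless_laplacian R m = N *m N^T.
Proof.
apply/matrixP => i j; rewrite !mxE.
under eq_bigr => k _ do
  rewrite !mxE mulrDr (eq_sym j).
rewrite big_split /= !sum_mul_delta.
rewrite (inj_eq (@ordS_inj m)) (eq_sym j i) mulr_natl mulr2n.
by rewrite [in RHS]addrA [RHS]addrC !addrA.
Qed.

(** With E = N N^T, an eigenvector v satisfies x |v|^2 = - |v N|^2. *)
Lemma signless_laplacian_eigenvalue_le0 (R : realFieldType) (m : nat) (x : R) :
  root (char_poly (- cycle_signless_laplacian R m)) x -> x <= 0.
Proof.
rewrite -eigenvalue_root_char => /eigenvalueP[v vE v0].
have sq0 (w : 'rV[R]_m) : 0 <= (w *m w^T) 0 0.
  by rewrite mxE sumr_ge0 // => k _; rewrite !mxE -expr2 sqr_ge0.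
have vv : 0 < (v *m v^T) 0 0.
  rewrite lt_neqAle sq0 andbT eq_sym mxE psumr_eq0; last first.
    by move=> k _; rewrite !mxE -expr2 sqr_ge0.
  apply: contra v0 => /allP h; apply/eqP/matrixP => i k; rewrite (ord1 i) mxE.
  by have := h k (mem_index_enum _); rewrite mxE mulf_eq0 orbb => /eqP.
have := sq0 (v *m \matrix_(i, j) ((i == j)%:R + (j == ordS i)%:R)).
rewrite trmx_mul mulmxA -(mulmxA v) -signless_laplacian_gram.
rewrite -[cycle_signless_laplacian _ _]opprK mulmxN vE mulNmx -scalemxAl.
by move: (v *m v^T) vv => q vv; rewrite !mxE oppr_ge0 pmulr_lle0.
Qed.

(** * Characteristic polynomials of the two bordered matrices *)

Lemma char_poly_dist_wheel (R : numFieldType) (m : nat) : (2 < m)%N ->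
  ('X + 4) * char_poly (dist_mx R (wheel m.+1)) =
  ('X^2 - (2 * m%:R - 4) * 'X - m%:R) *
    char_poly (- cycle_signless_laplacian R m).
Proof.
move=> hm; rewrite dist_mx_wheel // /char_poly /char_poly_mx.
set E := cycle_signless_laplacian R m; set Y := 'X%:M - map_mx polyC (- E).
have hY : const_mx 1 *m Y = ('X + 4) *: (const_mx 1 : 'rV[{poly R}]_m).
  rewrite /Y map_mxN opprK mulmxDr mul_mx_scalar scalerDl.
  have -> : const_mx 1 = map_mx polyC (const_mx 1) :> 'rV[{poly R}]_m.
    by rewrite map_const_mx.
  rewrite -map_mxM signless_laplacian_colsum; congr (_ + _).
  by apply/matrixP => i j; rewrite !mxE /= !mulr1 polyC_natr.
rewrite map_block_mx scalar_mx_block opp_block_mx add_block_mx.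
rewrite !map_const_mx !sub0r.
(* [U] subtracts twice the hub row from every cycle row, which cancels the constant 2 and leaves [Y]
   as the cyclic block. *)
pose U : 'M[{poly R}]_(1 + m) := block_mx 1%:M 0 (const_mx (- 2)) 1%:M.
have detU : \det U = 1 by rewrite det_lblock !det1 mulr1.
rewrite -[\det (block_mx _ _ _ _)]mul1r.
rewrite -[X in X * \det (block_mx _ _ _ _)]detU -det_mulmx mulmx_block.
rewrite !mul0mx !mul1mx !addr0.
have -> : const_mx (- 2) *m ('X%:M - map_mx polyC 0%:M) + - const_mx 1%:P
    = const_mx (- (1 + 2 * 'X)) :> 'cV[{poly R}]_m.
  apply/matrixP => i j; rewrite !mxE big_ord1 !mxE (ord1 j) !eqxx mulr1n mul0rn.
  by rewrite subr0; ring.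
have -> : (const_mx (- 2) : 'cV_m) *m (- const_mx 1%:P) +
    ('X%:M - map_mx polyC (const_mx 2 - E)) = Y.
  apply/matrixP => i j; rewrite !mxE big_ord1 !mxE.
  by rewrite !polyCD !polyCN polyC1; ring.
have -> : 'X%:M - map_mx polyC 0%:M = 'X%:M :> 'M[{poly R}]_1.
  by rewrite map_scalar_mx !raddf0 addr0.
have -> : - const_mx 1%:P = const_mx (- 1) :> 'rV[{poly R}]_m.
  by apply/matrixP => i j; rewrite !mxE.
rewrite (det_border_const _ _ _ hY); congr (_ * _).
by ring.
Qed.

Lemma char_poly_special_laplacian (R : numFieldType) (m : nat) :
  odd m -> (2 < m)%N ->
  ('X - (2^-1)%:P) * char_poly (special_laplacian R m.+1) =
  'X * ('X - (m.+1%:R / 2)%:P) *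
    char_poly (\matrix_(i, j) wheel_circ_coef R m ((j + m - i) %% m) : 'M_m).
Proof.
move=> om hm; rewrite special_laplacian_block // /char_poly /char_poly_mx.
set M := \matrix_(i, j) _; set Y := 'X%:M - map_mx polyC M.
have hM : const_mx 1 *m M = 2^-1 *: (const_mx 1 : 'rV[R]_m).
  (* The known product has the factors in the other order; a one-sided inverse of a square matrix is
     two-sided. The column sums 4 of the signless Laplacian then give 2 / 4 for [M]. *)
  have EM : cycle_signless_laplacian R m *m M = 2%:M.
    have two0 : 2 != 0 :> R by rewrite pnatr_eq0.
    have /mulmx1C : (2^-1 *: M) *m cycle_signless_laplacian R m = 1%:M.
      by rewrite -scalemxAl wheel_circ_mul_signless // scale_scalar_mx mulVf.
    rewrite -scalemxAr => /(congr1 (fun A => 2 *: A)).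
    by rewrite scalerA divff // scale1r scale_scalar_mx mulr1.
  have := congr1 (mulmx^~ M) (signless_laplacian_colsum R m).
  rewrite -mulmxA EM mul_mx_scalar -scalemxAl => /(congr1 (fun A => 4^-1 *: A)).
  rewrite !scalerA mulVf ?pnatr_eq0 // scale1r => <-.
  by congr (_ *: _); field.
have hY : const_mx 1 *m Y = ('X - (2^-1)%:P) *: (const_mx 1 : 'rV[{poly R}]_m).
  rewrite /Y mulmxBr mul_mx_scalar scalerBl.
  have -> : const_mx 1 = map_mx polyC (const_mx 1) :> 'rV[{poly R}]_m.
    by rewrite map_const_mx.
  by rewrite -map_mxM hM map_mxZ.
rewrite map_block_mx scalar_mx_block opp_block_mx add_block_mx.
rewrite !map_const_mx !sub0r map_scalar_mx -raddfB.
have cE k l : - const_mx (- 2^-1)%:P = const_mx (2^-1)%:P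
    :> 'M[{poly R}]_(k, l).
  by apply/matrixP => i j; rewrite !mxE polyCN opprK.
rewrite !cE (det_border_const _ _ _ hY); congr (_ * _).
have -> : (m.+1%:R / 2)%:P = (m%:R / 2)%:P + (2^-1)%:P :> {poly R}.
  by rewrite -polyCD -natr1 mulrDl mul1r.
have -> : (m%:R / 2)%:P = m%:R * (2^-1)%:P :> {poly R}.
  by rewrite polyCM polyC_natr.
by ring.
Qed.


(** * Comparison of the two spectra *)

Lemma sorted_map_iota (R : realDomainType) (f : nat -> R) (a k : nat) :
  (forall i j, (a <= i)%N -> (i <= j)%N -> (j < a + k)%N -> f j <= f i) ->
  sorted >=%R (map f (iota a k)).
Proof.
move=> hf; apply/(sortedP 0) => i; rewrite size_map size_iota => lti.
have ltik : (i < k)%N by lia.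
rewrite !(nth_map 0%N) ?size_iota ?nth_iota //.
by apply: hf; lia.
Qed.

Lemma perm_cons_max (R : realDomainType) (a y : R) (s t : seq R) :
  perm_eq (y :: t) (a :: s) -> all (<= y) t -> all (<= a) s ->
  y = a /\ perm_eq t s.
Proof.
move=> pyt ty sa; suff ya : y = a by move: pyt; rewrite ya perm_cons.
apply/eqP; rewrite eq_le; apply/andP; split.
- have := mem_head y t; rewrite (perm_mem pyt) inE => /predU1P[-> //|].
  exact: (allP sa).
- have := mem_head a s; rewrite -(perm_mem pyt) inE => /predU1P[-> //|].
  exact: (allP ty).
Qed.

Lemma perm_cons_min (R : realDomainType) (a y : R) (s t : seq R) :
  perm_eq (y :: t) (a :: s) -> all (>= y) t -> all (>= a) s ->
  y = a /\ perm_eq t s.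
Proof.
move=> pyt ty sa; suff ya : y = a by move: pyt; rewrite ya perm_cons.
apply/eqP; rewrite eq_le; apply/andP; split.
- have := mem_head a s; rewrite -(perm_mem pyt) inE => /predU1P[-> //|].
  exact: (allP ty).
- have := mem_head y t; rewrite (perm_mem pyt) inE => /predU1P[-> //|].
  exact: (allP sa).
Qed.

Lemma monic_dvd_prod_XsubC (F : fieldType) (p : {poly F}) (r : seq F) :
  p \is monic -> p %| \prod_(x <- r) ('X - x%:P) ->
  exists s : seq F, p = \prod_(x <- s) ('X - x%:P).
Proof.
move=> mp /dvdp_prod_XsubC[b]; exists (mask b r).
by apply/eqP; rewrite -eqp_monic ?monic_prod_XsubC.
Qed.

(** The quadratic belongs to the quotient of D by the partition into hub and cycle. Its roots are
    [k - 2 + r] and [k - 2 - r], and its sign at - 4 / n locates the smaller one. *)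
Lemma wheel_quotient_roots (R : rcfType) (m : nat) : (2 < m)%N ->
  exists p v : R, [/\ 0 < p, v < 0, v <= - (4 / m.+1%:R) &
    'X^2 - (2 * m%:R - 4) * 'X - m%:R = ('X - p%:P) * ('X - v%:P)].
Proof.
move=> hm; pose k : R := m%:R; pose r := Num.sqrt ((k - 2) ^+ 2 + k).
have k3 : 3 <= k by rewrite ler_nat.
have r2 : r ^+ 2 = (k - 2) ^+ 2 + k by rewrite sqr_sqrtr //; nra.
have r0 : 0 <= r by apply: sqrtr_ge0.
have rk : k - 2 < r by nra.
exists (k - 2 + r), (k - 2 - r); split; [lra|lra| |].
- have n0 : 0 < m.+1%:R :> R by rewrite ltr0n.
  have nk : m.+1%:R = k + 1 :> R by rewrite natr1.
  set z := 4 / m.+1%:R.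
  have zn : z * (k + 1) = 4 by rewrite /z nk divfK // -nk gt_eqF.
  have z0 : 0 < z by rewrite divr_gt0.
  (* n^2 times the quadratic at - 4 / n is - (n - 1) (n - 4)^2 *)
  have quad : (- z - (k - 2 + r)) * (- z - (k - 2 - r)) <= 0.
    have -> : (- z - (k - 2 + r)) * (- z - (k - 2 - r)) =
              z ^+ 2 + 2 * (k - 2) * z + (k - 2) ^+ 2 - r ^+ 2 by ring.
    rewrite r2 -(pmulr_lle0 _ (exprn_gt0 2 (_ : 0 < k + 1))); last lra.
    have -> : (z ^+ 2 + 2 * (k - 2) * z + (k - 2) ^+ 2 - ((k - 2) ^+ 2 + k)) *
        (k + 1) ^+ 2 = (z * (k + 1)) ^+ 2 +
        2 * (k - 2) * (z * (k + 1)) * (k + 1) - k * (k + 1) ^+ 2 by ring.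
    rewrite zn.
    have -> : 4 ^+ 2 + 2 * (k - 2) * 4 * (k + 1) - k * (k + 1) ^+ 2 =
      - (k * (k - 3) ^+ 2) by ring.
    by rewrite oppr_le0 mulr_ge0 ?sqr_ge0 //; lra.
  (* The factor with the positive root is negative at [- z], so the other is nonnegative. *)
  rewrite -subr_ge0; move: quad; rewrite nmulr_rle0 //; lra.
- have -> : 'X^2 - (2 * m%:R - 4) * 'X - m%:R =
     'X^2 - (2 * k - 4)%:P * 'X - k%:P :> {poly R}.
    by rewrite polyCD polyCN polyCM !polyC_natr.
  have -> : (2 * k - 4)%:P = (k - 2 + r)%:P + (k - 2 - r)%:P.
    by rewrite -polyCD; congr _%:P; ring.
  have -> : k%:P = - ((k - 2 + r)%:P * (k - 2 - r)%:P).
    rewrite -polyCM -polyCN; congr _%:P.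
    have -> : - ((k - 2 + r) * (k - 2 - r)) = r ^+ 2 - (k - 2) ^+ 2 by ring.
    by rewrite r2; ring.
  by ring.
Qed.

Lemma wheel_spectra (R : rcfType) (m : nat) (r : seq R) :
  odd m -> (2 < m)%N ->
  char_poly (dist_mx R (wheel m.+1)) = \prod_(x <- r) ('X - x%:P) ->
  exists (p v : R) (s : seq R),
  [/\ [/\ 0 < p, v < 0 & v <= - (4 / m.+1%:R)], all (< 0) s,
      char_poly (dist_mx R (wheel m.+1)) =
        \prod_(x <- [:: p, v & s]) ('X - x%:P) &
      char_poly (special_laplacian R m.+1) =
        \prod_(x <- [:: 0, m.+1%:R / 2 & [seq - 2 / x | x <- s]]) ('X - x%:P)].
Proof.
move=> om hm hr; have [p [v [p0 v0 vn quadE]]] := wheel_quotient_roots R hm.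
set E := cycle_signless_laplacian R m.
have ME := wheel_circ_mul_signless R om hm; set M := (\matrix_(i, j) _) in ME.
have hD := char_poly_dist_wheel R hm.
have hL := char_poly_special_laplacian R om hm.
rewrite -/M in hL; rewrite -/E in hD ME.
have X4 : 'X + 4 = 'X - (- 4)%:P :> {poly R} by rewrite polyCN polyC_natr opprK.
(* At -4 the left side of [hD] vanishes while the quadratic equals 7 m, so -4 is a root of
   [char_poly (- E)]. *)
have [q hq] : exists q, char_poly (- E) = q * ('X - (- 4)%:P).
  apply/factor_theorem; have := congr1 (horner^~ (- 4)) hD.
  rewrite X4 !hornerM quadE !hornerE /= subrr mul0r => /esym/eqP.
  rewrite mulf_eq0 => /orP[|//].
  have := congr1 (horner^~ (- 4)) quadE; rewrite !hornerE /= => <-.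
  have m3 : 3 <= m%:R :> R by rewrite ler_nat.
  rewrite -!polyC_natr !hornerE => /eqP h; exfalso; move: h; lra.
have qm : q \is monic.
  by have := char_poly_monic (- E); rewrite hq monicMr ?monicXsubC.
have hDq : char_poly (dist_mx R (wheel m.+1)) = ('X - p%:P) * ('X - v%:P) * q.
  have X40 : 'X - (- 4)%:P != 0 :> {poly R} by rewrite polyXsubC_eq0.
  apply: (mulfI X40).
  by rewrite -X4 hD quadE hq X4 [q * _]mulrC mulrCA.
(* [q] splits because it divides the characteristic polynomial of D, which splits by [hr]. *)
have [s hs] : exists s : seq R, q = \prod_(x <- s) ('X - x%:P).
  apply: (@monic_dvd_prod_XsubC _ _ r) => //.
  by rewrite -hr hDq dvdp_mull.
have hE : char_poly (- E) = \prod_(x <- - 4 :: s) ('X - x%:P).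
  by rewrite hq hs big_cons mulrC.
have neg : all (< 0) (- 4 :: s).
  apply/allP => x xs; have rx : root (char_poly (- E)) x.
    by rewrite hE root_prod_XsubC.
  rewrite /= lt_neqAle (signless_laplacian_eigenvalue_le0 rx) andbT.
  (* Zero is excluded because [M *m E] is the scalar matrix 2, which makes [E] invertible. *)
  apply: contraTneq rx => ->; rewrite rootE horner_char_poly raddf0 sub0r opprK.
  have := congr1 determinant ME; rewrite det_mulmx det_scalar => h.
  have : \det M * \det E != 0 by rewrite h expf_neq0 // pnatr_eq0.
  by rewrite mulf_eq0 negb_or => /andP[].
have hM : char_poly M = \prod_(x <- - 4 :: s) ('X - (- 2 / x)%:P).
  apply: (@char_poly_scaled_inverse _ _ M (- E)) => //.
    by rewrite mulmxN ME -raddfN.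
  by apply: sub_all neg => x; apply: ltr0_neq0.
exists p, v, s; split => //; first by case/andP: neg.
  by rewrite hDq hs !big_cons mulrA.
have X2 : 'X - (2^-1)%:P != 0 :> {poly R} by rewrite polyXsubC_eq0.
apply: (mulfI X2); rewrite hL hM !big_cons big_map subr0.
(* The eigenvalue -4 of [- E] becomes 1 / 2 for [M] and cancels the extra factor. *)
have -> : - 2 / - 4 = 2^-1 :> R by field.
by rewrite mulrCA !mulrA.
Qed.

Theorem theorem5 (R : rcfType) (n : nat) (hn : (4 <= n)%N) (hev : ~~ odd n)
    (mu lambda : nat -> R)
    (hmu : arranged_eigenvalues (dist_mx R (wheel n)) mu)
    (hlambda : arranged_eigenvalues (special_laplacian R n) lambda) :
  [/\ 0 < mu 1%N /\ mu 2%N < 0,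
      0 < lambda n.-1 /\ lambda n = 0,
      - (2 / lambda 1%N) < 0,
      (forall i : nat, (1 <= i <= n.-1)%N ->
         mu i.+1 <= - (2 / lambda i)) &
      (forall i : nat, (2 <= i <= n.-1)%N ->
         - (2 / lambda i) <= mu i)].
Proof.
case: n hn hev hmu hlambda => // m hm; rewrite /= negbK => om.
move=> [hmu mu_mono] [hlam lam_mono].
have prodE (f : nat -> R) : \prod_(1 <= i < (1 + m).+1) ('X - (f i)%:P) =
    \prod_(x <- [seq f i | i <- iota 1 m.+1]) ('X - x%:P).
  by rewrite big_map /index_iota subn1.
have [p [v [s [[p0 v0 vn] sneg hD hL]]]] :=
  wheel_spectra om hm (etrans hmu (prodE mu)).
have /prod_XsubC_eq pmu := etrans (esym (etrans hmu (prodE mu))) hD.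
have /prod_XsubC_eq plam := etrans (esym (etrans hlam (prodE lambda))) hL.
have [mu1 {}pmu] : mu 1%N = p /\ perm_eq (map mu (iota 2 m)) (v :: s).
  apply: perm_cons_max pmu _ _.
  - apply/allP => x /mapP[i]; rewrite mem_iota => hi ->{x}.
    by apply: mu_mono; lia.
  - apply/allP => x; rewrite inE => /predU1P[->|/(allP sneg) /ltW x0].
      by rewrite /= (le_trans (ltW v0)) // ltW.
    by rewrite /= (le_trans x0) // ltW.
have n0 : 0 < m.+1%:R / 2 :> R by rewrite divr_gt0 ?ltr0n.
(* The eigenvalue 0 is the minimum and sits last; the list is rotated to bring it to the head. *)
have [lam1 {}plam] : lambda m.+1 = 0 /\
    perm_eq (map lambda (iota 1 m)) (m.+1%:R / 2 :: [seq - 2 / x | x <- s]).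
  apply: perm_cons_min.
  - apply: perm_trans plam.
    have -> : iota 1 m.+1 = iota 1 m ++ [:: m.+1].
      by rewrite -[m.+1 in LHS]addn1 iotaD add1n.
    rewrite map_cat.
    by rewrite -cat1s perm_catC.
  - apply/allP => x /mapP[i]; rewrite mem_iota => hi ->{x}.
    by apply: lam_mono; lia.
  - apply/allP => x; rewrite inE => /predU1P[->|/mapP[y /(allP sneg) /= y0 ->]].
      exact: ltW.
    by rewrite mulr_le0 ?invr_le0 ?oppr_le0 // ltW.
have lam_pos i : (1 <= i <= m)%N -> 0 < lambda i.
  move=> hi; have : lambda i \in map lambda (iota 1 m).
    by apply: map_f; rewrite mem_iota; lia.
  rewrite (perm_mem plam) inE => /predU1P[->//|/mapP[y /(allP sneg) /= y0 ->]].
  by rewrite nmulr_rgt0 ?invr_lt0 // oppr_lt0.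
have mu_neg i : (2 <= i <= m.+1)%N -> mu i < 0.
  move=> hi; have : mu i \in map mu (iota 2 m).
    by apply: map_f; rewrite mem_iota; lia.
  by rewrite (perm_mem pmu) inE => /predU1P[->//|]; apply: (allP sneg).
(* The map x to - 2 / x is an involution on nonzero numbers: it restores [s] and sends n / 2 to - 4
   / n. *)
have pneg : perm_eq (map (fun i => - (2 / lambda i)) (iota 1 m))
    (- (4 / m.+1%:R) :: s).
  have := perm_map (fun x => - (2 / x)) plam; rewrite -map_comp /= -map_comp.
  have -> : - (2 / (m.+1%:R / 2)) = - (4 / m.+1%:R) :> R.
    by field; rewrite addrC natr1 pnatr_eq0.
  congr (perm_eq _ (_ :: _)); rewrite -[RHS]map_id; apply/eq_in_map => x xs /=.
  by field; apply: ltr0_neq0; apply: (allP sneg).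
have smu : sorted >=%R (map mu (iota 2 m)).
  by apply: sorted_map_iota => i j ? ? ?; apply: mu_mono; lia.
have slam : sorted >=%R (map (fun i => - (2 / lambda i)) (iota 1 m)).
  apply: sorted_map_iota => i j i1 ij jm.
  have li : 0 < lambda i by apply: lam_pos; lia.
  have lj : 0 < lambda j by apply: lam_pos; lia.
  rewrite lerN2 ler_pM2l // lef_pV2 ?posrE //.
  by apply: lam_mono; lia.
have szs : (size s).+1 = m.
  by have /= <- := perm_size pmu; rewrite size_map size_iota.
(* Entry [i] of the two lists is - 2 / lambda_(i+1) and mu_(i+2), which produces the index shifts
   below. *)
have [le1 le2] := sorted_cons_interlace vn slam smu pneg pmu.
split.
- by rewrite mu1 p0; split=> //; apply: mu_neg; lia.
- by rewrite lam1; split=> //; apply: lam_pos; lia.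
- by rewrite oppr_lt0 divr_gt0 //; apply: lam_pos; lia.
- move=> [|i] // hi; have := le1 i; rewrite szs.
  by rewrite !(nth_map 0%N) ?size_iota ?nth_iota //; apply.
- move=> [|[|i]] // /andP[_ hi]; have him : (i < m)%N by lia.
  have := le2 i; rewrite -ltnS szs.
  by rewrite !(nth_map 0%N) ?size_iota ?nth_iota //; apply.
Qed.
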